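(* Let $N$ be a finite loop, let $H=\langle u\rangle$ be a cyclic group, and let $\phi: H\to \mathrm{SemiAut}(N)$ be a group homomorphism. Put $f=\phi(u)$ and suppose that the order $|\phi(u)|$ of $f$ in $\mathrm{SemiAut}(N)$ is coprime to $3$. Define $G=(N,H,\phi)$ to be the set $N\times H$ with multiplication $$(x,u^{m})(y,u^{n})=\Big(f^{\frac{2m+n}{3}}\big(f^{\frac{-2m-n}{3}}(x)\, f^{\frac{m-n}{3}}(y)\big),\,u^{m+n}\Big)$$ for $x,y\in N$ and integers $m,n$. Then $G$ is an IP loop if and only if $N$ is an IP loop.
   Context: A loop is a set $Q$ with a binary operation such that for all $a,b\in Q$ the equations $ax=b$ and $ya=b$ have unique solutions $x,y\in Q$, and there is a two-sided identity element $1\in Q$. A loop $Q$ is an inverse property loop (IP loop) if every $x\in Q$ has a two-sided inverse $x^{-1}$ and $(yx^{-1})x=y=x(x^{-1}y)$ for all $x,y\in Q$. A semiautomorphism of a loop $Q$ is a bijection $f:Q\to Q$ with $f(1)=1$ and $f(x(yx))=f(x)(f(y)f(x))$ for all $x,y\in Q$; $\mathrm{SemiAut}(Q)$ is the group of semiautomorphisms of $Q$ under composition. Since the order of $f$ is finite and coprime to $3$, $f$ has a unique cube root $f^{1/3}$ in the cyclic group $\langle f\rangle$, and for an integer $k$ one writes $f^{k/3}=(f^{1/3})^k$. *)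

(* Defs.v *)
From mathcomp Require Import all_boot all_order all_fingroup all_algebra.
From mathcomp Require Import cyclic ring.

Set Implicit Arguments.
Unset Strict Implicit.
Unset Printing Implicit Defensive.

Import GRing.Theory.
Local Open Scope group_scope.

Definition is_loop (Q : Type) (op : Q -> Q -> Q) (e : Q) : Prop :=
  [/\ forall a b, exists! x, op a x = b,
      forall a b, exists! y, op y a = b,
      left_id e op & right_id e op].

Definition is_inverse (Q : Type) (op : Q -> Q -> Q) (e x x' : Q) : Prop :=
  op x x' = e /\ op x' x = e.

(* The identity is existentially quantified (it is unique), so that being an  *)
(* IP loop is a property of the binary operation alone.                       *)
Definition is_IP_loop (Q : Type) (op : Q -> Q -> Q) : Prop :=
  exists2 e, is_loop op e &
    forall x, exists2 x', is_inverse op e x x' &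
      forall y, op (op y x') x = y /\ y = op x (op x' y).

(* On a finite carrier the bijections are the permutations. The product of    *)
(* {perm Q} is composition in the opposite order, s * t = t \o s; this is     *)
(* immaterial for powers and for homomorphisms from a commutative group.      *)
Definition SemiAut (Q : finType) (op : Q -> Q -> Q) (e : Q) : {set {perm Q}} :=
  [set f : {perm Q} | (f e == e) &&
     [forall x, forall y, f (op x (op y x)) == op (f x) (op (f y) (f x))]].

Lemma SemiAutP (Q : finType) (op : Q -> Q -> Q) (e : Q) (f : {perm Q}) :
  reflect (f e = e /\ forall x y, f (op x (op y x)) = op (f x) (op (f y) (f x)))
          (f \in SemiAut op e).
Proof.
rewrite inE; apply: (iffP andP) => -[fe fM].
  split; first exact/eqP.
  by move=> x y; move/forallP/(_ x)/forallP/(_ y)/eqP: fM.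
split; first exact/eqP.
by apply/forallP => x; apply/forallP => y; rewrite fM.
Qed.

Lemma SemiAut_group_set (Q : finType) (op : Q -> Q -> Q) (e : Q) :
  group_set (SemiAut op e).
Proof.
apply/group_setP; split.
  by apply/SemiAutP; split => [|x y]; rewrite !perm1.
move=> f g /SemiAutP[fe fM] /SemiAutP[ge gM].
by apply/SemiAutP; split => [|x y]; rewrite !permM ?fe ?ge // fM gM.
Qed.

Canonical SemiAut_group (Q : finType) (op : Q -> Q -> Q) (e : Q) :=
  Group (SemiAut_group_set op e).

Definition expgz (G : groupType) (g : G) (k : int) : G :=
  match k with Posz n => g ^+ n | Negz n => g ^- n.+1 end.

(* H = <u>; the group H may be finite or infinite. *)
Definition generated_by (H : groupType) (u : H) : Prop :=
  forall h : H, exists m : int, h == expgz u m.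

Definition zlog (H : groupType) (u : H) (Hu : generated_by u) (h : H) : int :=
  xchoose (Hu h).

(* The cube root of f in <f>, unique if the order of f is coprime to 3: see  *)
(* cbrtP below. The default value 1 is never reached in that case.            *)
Definition cbrt (gT : finGroupType) (f : gT) : gT :=
  odflt 1 [pick g in <[f]> | g ^+ 3 == f].

(* f^{k/3} *)
Definition exp3 (gT : finGroupType) (f : gT) (k : int) : gT := expgz (cbrt f) k.

(* The multiplication of (N, H, phi) on N * H, with H = <u>. The exponents m  *)
(* and n are only determined modulo the order of u; ext_mulE below shows that *)
(* the choice made by zlog is irrelevant.                                     *)
Definition ext_mul (N : finType) (op : N -> N -> N) (H : groupType) (u : H)
    (Hu : generated_by u) (phi : {multiplicative H -> {perm N}})
    (p q : N * H) : N * H :=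
  let f := phi u in
  let m := zlog Hu p.2 in
  let n := zlog Hu q.2 in
  (exp3 f (2 * m + n)%R
     (op (exp3 f (- (2 * m) - n)%R p.1) (exp3 f (m - n)%R q.1)),
   p.2 * q.2).

Lemma expgz_subn (G : groupType) (g : G) (a b : nat) :
  expgz g (Posz a - Posz b)%R = g ^+ a * g ^- b.
Proof.
have [le_ba|/ltnW le_ab] := leqP b a.
  by rewrite subzn //= -{2}(subnK le_ba) expgnDr mulgK.
rewrite -[(a%:Z - b%:Z)%R]opprK opprB subzn // -{2}(subnK le_ab).
rewrite expgnDr invgM mulgA mulgV mul1g.
by case: (b - a)%N => [|k] //=; rewrite invg1.
Qed.

Lemma int_subnP (k : int) : exists a b : nat, k = (Posz a - Posz b)%R.
Proof.
case: k => n; first by exists n, 0%N; rewrite subr0.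
by exists 0%N, n.+1; rewrite NegzE sub0r.
Qed.

Lemma expgzD (G : groupType) (g : G) (j k : int) :
  expgz g (j + k)%R = expgz g j * expgz g k.
Proof.
have [a [b ->]] := int_subnP j; have [c [d ->]] := int_subnP k.
have -> : (a%:Z - b%:Z + (c%:Z - d%:Z) = (a + c)%N%:Z - (b + d)%N%:Z)%R.
  by rewrite !PoszD; ring.
rewrite !expgz_subn addnC expgnDr [(b + d)%N]addnC expgnDr invgM -!mulgA.
have C : commute (g ^+ c) (g ^+ a * g ^- b).
  apply: commuteM; first exact/commuteX2.
  exact/commuteV/commuteX2.
rewrite !mulgA -[g ^+ c * g ^+ a * _]mulgA C -!mulgA; congr (_ * (_ * _)).
Qed.

Lemma expgzN (G : groupType) (g : G) (k : int) :
  expgz g (- k)%R = (expgz g k)^-1.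
Proof. by apply: (mulgI (expgz g k)); rewrite -expgzD subrr mulgV. Qed.

Lemma morph_expgz (G K : groupType) (phi : {multiplicative G -> K}) (g : G)
    (k : int) : phi (expgz g k) = expgz (phi g) k.
Proof.
have phi1 : phi 1 = 1 by apply: (mulgI (phi 1)); rewrite -gmulfM !mulg1.
have phiX n : phi (g ^+ n) = phi g ^+ n.
  by elim: n => [|n IHn]; rewrite ?expg0 // !expgS gmulfM IHn.
case: k => n /=; first exact: phiX.
by rewrite -phiX; apply: (mulgI (phi (g ^+ n.+1))); rewrite -gmulfM !mulgV.
Qed.

Lemma cbrtP (gT : finGroupType) (f g : gT) : coprime #[f] 3 ->
  (g \in <[f]> /\ g ^+ 3 = f) <-> g = cbrt f.
Proof.
move=> co_f3; have inv3 := expgK (G := [group of <[f]>]) co_f3.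
rewrite /cbrt; case: pickP => [h /andP[hf /eqP h3] | no] /=; last first.
  case/negP: (negbT (no (f ^+ expg_invn <[f]> 3))).
  rewrite mem_cycle -expgnA mulnC expgnA; apply/eqP/inv3; exact: cycle_id.
split=> [[gf g3]|->] //.
by rewrite -(inv3 g gf) -(inv3 h hf) /= g3 h3.
Qed.

Lemma eq_exp3 (gT : finGroupType) (f : gT) (j k : int) :
  coprime #[f] 3 -> expgz f j = expgz f k -> exp3 f j = exp3 f k.
Proof.
move=> co_f3 Ejk; have [cf c3] := (cbrtP (cbrt f) co_f3).2 erefl.
have inv3 := expgK (G := [group of <[f]>]) co_f3.
have mem_z i : expgz (cbrt f) i \in <[f]>.
  by case: i => i /=; rewrite ?groupV groupX.
have z3 i : expgz (cbrt f) i ^+ 3 = expgz f i.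
  by rewrite -[in RHS]c3; case: i => i /=; rewrite ?expVgn -!expgnA mulnC.
by rewrite /exp3 -(inv3 _ (mem_z j)) -(inv3 _ (mem_z k)) !z3 Ejk.
Qed.

Lemma ext_mulE (N : finType) (op : N -> N -> N) (H : groupType) (u : H)
    (Hu : generated_by u) (phi : {multiplicative H -> {perm N}})
    (x y : N) (m n : int) : coprime #[phi u] 3 ->
  ext_mul op Hu phi (x, expgz u m) (y, expgz u n) =
    (exp3 (phi u) (2 * m + n)%R
       (op (exp3 (phi u) (- (2 * m) - n)%R x) (exp3 (phi u) (m - n)%R y)),
     expgz u (m + n)%R).
Proof.
move=> co_f3; rewrite /ext_mul /= -expgzD.
have key i : exp3 (phi u) (zlog Hu (expgz u i)) = exp3 (phi u) i.
  apply: eq_exp3 => //; rewrite -!morph_expgz.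
  by rewrite -(eqP (xchooseP (Hu (expgz u i)))).
have D i j : exp3 (phi u) (i + j)%R = exp3 (phi u) i * exp3 (phi u) j.
  exact: expgzD.
have V i : exp3 (phi u) (- i)%R = (exp3 (phi u) i)^-1 by exact: expgzN.
have T (i : int) : (2 * i = i + i)%R by ring.
by rewrite !T !(D, V) !key.
Qed.

(* Main.v *)
Require Import Defs.
From mathcomp Require Import all_boot all_order all_fingroup all_algebra.
From mathcomp Require Import ring.

Set Implicit Arguments.
Unset Strict Implicit.
Unset Printing Implicit Defensive.

Local Open Scope group_scope.

(** Let g be the cube root of f. A semiautomorphism of an IP loop preserves
    inverses, since f(x) = f(x(x^-1 x)) = f(x)(f(x^-1) f(x)). Hence the candidate
    inverse of (x, u^m) in G is (g^(-3m)(x^-1), u^(-m)), and each of the four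
    cancellation laws of G reduces, once the powers of g are collected, to the
    same law of N: for instance (x, u^m)^-1 ((x, u^m)(y, u^n)) has first component
    g^(n-m)(X^-1 (X . g^(m-n)(y))) with X = g^(-2m-n)(x). Conversely N embeds in G
    as N * {1}, which is closed under inverses. *)

(** Phrased without identity or divisibility, so that it passes between [N] and [G] by computing
    products alone. *)
Definition ip_inverse (Q : Type) (op : Q -> Q -> Q) (x x' : Q) : Prop :=
  forall y, [/\ op x' (op x y) = y, op x (op x' y) = y,
                op (op y x) x' = y & op (op y x') x = y].

(** Cancellation already gives divisibility: [op a' b] and [op b a'] are the only solutions of the
    two equations. Thus unique division in [G] needs no separate check. *)
Lemma ip_inverse_IP_loop (Q : Type) (op : Q -> Q -> Q) (e : Q) :
  left_id e op -> right_id e op -> (forall x, exists x', ip_inverse op x x') ->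
  is_IP_loop op.
Proof.
move=> op1x opx1 inv; exists e.
  split=> // a b; have [a' aa'] := inv a.
    exists (op a' b); split=> [|x <-]; first by have [] := aa' b.
    by have [] := aa' x.
  exists (op b a'); split=> [|x <-]; first by have [] := aa' b.
  by have [] := aa' x.
move=> x; have [x' xx'] := inv x; exists x'; last by move=> y; have [] := xx' y.
by have [_ + _ +] := xx' e; rewrite opx1 op1x.
Qed.

(** Two of the four laws are given. The others follow by cancelling [x], as in x(x'(xy)) = xy. *)
Lemma IP_loop_ip_inverse (Q : Type) (op : Q -> Q -> Q) (x : Q) :
  is_IP_loop op -> exists x', ip_inverse op x x'.
Proof.
case=> e [divl divr _ _] inv; have [x' _ xx'] := inv x; exists x' => y.
have cancell a b c : op a b = op a c -> b = c.
  by have [d [_ uniq]] := divl a (op a c) => /uniq <-; apply: uniq.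
have cancelr a b c : op b a = op c a -> b = c.
  by have [d [_ uniq]] := divr a (op c a) => /uniq <-; apply: uniq.
have [yx'x xx'y] := xx' y; split=> //.
  by apply: (cancell x); have [_ <-] := xx' (op x y).
by apply: (cancelr x); have [-> _] := xx' (op y x).
Qed.

Lemma SemiAut_ip_inverse (N : finType) (op : N -> N -> N) (e : N) (f : {perm N})
    (x x' : N) :
  left_id e op -> right_id e op -> is_IP_loop op -> f \in SemiAut op e ->
  ip_inverse op x x' -> ip_inverse op (f x) (f x').
Proof.
move=> op1x opx1 ip /SemiAutP[_ fM] xx'.
have [z fxz] := IP_loop_ip_inverse (f x) ip.
suff -> : f x' = z by [].
have fx'x : op (f x') (f x) = e.
  (* Applying [f] to x(x'x) = x gives f(x)(f(x')f(x)) = f(x); multiplying by [z] on the left removes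
     f(x). *)
  have [_ + _ _] := xx' x; move=> /(congr1 f); rewrite fM => fxE.
  have [<- _ _ _] := fxz (op (f x') (f x)).
  by rewrite fxE; have [+ _ _ _] := fxz e; rewrite opx1.
by have [_ _ + _] := fxz (f x'); rewrite fx'x op1x.
Qed.

Lemma exp3_comp (N : finType) (f : {perm N}) (j k : int) (x : N) :
  exp3 f j (exp3 f k x) = exp3 f (k + j)%R x.
Proof. by rewrite /exp3 expgzD permM. Qed.

Lemma exp3_0 (N : finType) (f : {perm N}) (x : N) : exp3 f 0%R x = x.
Proof. by rewrite /exp3 /= perm1. Qed.

(** The cube root lies in the cyclic group of [f], which is a subgroup of [SemiAut op e]. *)
Lemma exp3_SemiAut (N : finType) (op : N -> N -> N) (e : N) (f : {perm N})
    (k : int) :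
  coprime #[f] 3 -> f \in SemiAut op e -> exp3 f k \in SemiAut op e.
Proof.
move=> co_f3 fS; have [cf _] := (cbrtP (cbrt f) co_f3).2 erefl.
have cS : cbrt f \in SemiAut op e by apply: subsetP cf; rewrite cycle_subG.
by rewrite /exp3; case: k => n /=; rewrite ?groupV groupX.
Qed.

Section Extension.
Variables (N : finType) (op : N -> N -> N) (e : N).
Hypotheses (op1x : left_id e op) (opx1 : right_id e op).
Variables (H : groupType) (u : H) (Hu : generated_by u).
Variable phi : {multiplicative H -> {perm N}}.
Hypotheses (uS : phi u \in SemiAut op e) (co_u3 : coprime #[phi u] 3).

Let mulE := fun x y m n => ext_mulE op Hu x y m n co_u3.

Lemma exp3_fix k : exp3 (phi u) k e = e.
Proof. by have /SemiAutP[] := exp3_SemiAut k co_u3 uS. Qed.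

Lemma ext_mul1p : left_id (e, 1) (ext_mul op Hu phi).
Proof.
case=> y h; have [n /eqP->] := Hu h.
(* The identity of [H] is read as [expgz u 0], by conversion. *)
rewrite (mulE e y 0%R n) exp3_fix op1x exp3_comp; congr (_, expgz u _); last by ring.
by rewrite (_ : _ + _ = 0)%R ?exp3_0 //; ring.
Qed.

Lemma ext_mulp1 : right_id (e, 1) (ext_mul op Hu phi).
Proof.
case=> x h; have [m /eqP->] := Hu h.
rewrite (mulE x e m 0%R) exp3_fix opx1 exp3_comp; congr (_, expgz u _); last by ring.
by rewrite (_ : _ + _ = 0)%R ?exp3_0 //; ring.
Qed.

Lemma ext_mul_base x y : ext_mul op Hu phi (x, 1) (y, 1) = (op x y, 1).
Proof. by rewrite (mulE x y 0%R 0%R) !exp3_0. Qed.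

Lemma ext_ip_inverse x x' m : is_IP_loop op -> ip_inverse op x x' ->
  ip_inverse (ext_mul op Hu phi)
    (x, expgz u m) (exp3 (phi u) (- (3 * m))%R x', expgz u (- m)%R).
Proof.
move=> ip xx' [y h]; have [n /eqP->] := Hu h.
have EI k : ip_inverse op (exp3 (phi u) k x) (exp3 (phi u) k x').
  exact: SemiAut_ip_inverse (exp3_SemiAut k co_u3 uS) xx'.
(* In each law, the factor -3m gives x' the same exponent as x, and the power between the inner and
   the outer product vanishes. Then [EI] applies, and the powers left on y cancel. *)
split; rewrite !mulE !exp3_comp; congr (_, expgz u _); try ring.
- rewrite (_ : - (3 * m) + _ = - (2 * m) - n)%R; last by ring.
  rewrite (_ : 2 * m + n + _ = 0)%R ?exp3_0; last by ring.
  have [-> _ _ _] := EI (- (2 * m) - n)%R (exp3 (phi u) (m - n)%R y).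
  by rewrite exp3_comp (_ : _ + _ = 0)%R ?exp3_0 //; ring.
- rewrite (_ : - (3 * m) + _ = - (2 * m) - (- m + n))%R; last by ring.
  rewrite (_ : 2 * - m + n + _ = 0)%R ?exp3_0; last by ring.
  set k := (- (2 * m) - _)%R.
  have [_ -> _ _] := EI k (exp3 (phi u) (- m - n)%R y).
  by rewrite exp3_comp (_ : _ + _ = 0)%R ?exp3_0 // /k; ring.
- rewrite (_ : - (3 * m) + _ = n - m)%R; last by ring.
  rewrite (_ : 2 * n + m + _ = 0)%R ?exp3_0; last by ring.
  have [_ _ -> _] := EI (n - m)%R (exp3 (phi u) (- (2 * n) - m)%R y).
  by rewrite exp3_comp (_ : _ + _ = 0)%R ?exp3_0 //; ring.
- rewrite (_ : - (3 * m) + _ = n + - m - m)%R; last by ring.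
  rewrite (_ : 2 * n + - m + _ = 0)%R ?exp3_0; last by ring.
  set k := (n + - m - m)%R.
  have [_ _ _ ->] := EI k (exp3 (phi u) (- (2 * n) - - m)%R y).
  by rewrite exp3_comp (_ : _ + _ = 0)%R ?exp3_0 //; ring.
Qed.

Lemma base_ip_inverse x p : ip_inverse (ext_mul op Hu phi) (x, 1) p ->
  ip_inverse op x p.1.
Proof.
case: p => x' h xx'.
(* Testing on the identity forces the inverse back into the copy of [N]. *)
have h1 : h = 1 by have [/(congr1 snd) /=] := xx' (e, 1); rewrite !mulg1.
rewrite h1 in xx'; move=> y; have := xx' (y, 1).
by rewrite !ext_mul_base; case=> -[?] [?] [?] [?].
Qed.

End Extension.

Theorem theorem10 (N : finType) (op : N -> N -> N) (e : N)
  (N_loop : is_loop op e)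
  (H : groupType) (u : H) (Hu : generated_by u)
  (phi : {multiplicative H -> {perm N}})
  (phi_SemiAut : forall h : H, phi h \in SemiAut op e)
  (order_coprime : coprime #[phi u]%g 3) :
  is_IP_loop (ext_mul op Hu phi) <-> is_IP_loop op.
Proof.
have [_ _ op1x opx1] := N_loop; have uS := phi_SemiAut u.
split=> ip.
  apply: (ip_inverse_IP_loop op1x opx1) => x.
  have [p xp] := IP_loop_ip_inverse (x, 1) ip.
  by exists p.1; apply: base_ip_inverse xp.
apply: (ip_inverse_IP_loop (ext_mul1p op1x Hu uS order_coprime)).
  exact: ext_mulp1.
case=> x h; have [m /eqP->] := Hu h.
have [x' xx'] := IP_loop_ip_inverse x ip.
by eexists; apply: ext_ip_inverse xx'.
Qed.
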